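(* Let $k$ be a positive integer and let $G$ be a graph with a nearly-perfect matching of size $k$. Then $R(G)\geq \frac{3k^{2/3}}{2}-\sqrt{k/2}$.
   Context: All graphs are finite and simple. For a graph $G$, the Randić index is $R(G)=\sum_{uv\in E(G)} \frac{1}{\sqrt{d(u)d(v)}}$, where $d(\cdot)$ denotes degree in $G$. A matching in $G$ is nearly-perfect if it covers all but at most one vertex of $G$, i.e. it has size $\lfloor |V(G)|/2\rfloor$. *)

(* Defs.v *)
From HB Require Import structures.
From mathcomp Require Import all_boot all_order all_algebra.
From mathcomp Require Import reals.

Set Implicit Arguments.
Unset Strict Implicit.
Unset Printing Implicit Defensive.

Import Order.TTheory GRing.Theory Num.Theory.
Local Open Scope ring_scope.

Record sgraph := SGraph {
  vertex :> finType;
  adj : rel vertex;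
  adj_sym : symmetric adj;
  adj_irrefl : irreflexive adj
}.

(* An edge uv is the two-element set [set u; v], so it is counted once. *)
Definition edges (G : sgraph) : {set {set G}} :=
  [set [set p.1; p.2] | p : G * G & adj p.1 p.2].

Definition deg (G : sgraph) (v : G) : nat := #|[set w | adj v w]|.

(* For an edge f = uv the inner product is d(u) d(v), as u != v. *)
Definition randic (R : realType) (G : sgraph) : R :=
  \sum_(f in edges G) (Num.sqrt (\prod_(v in f) (deg v)%:R))^-1.

Definition is_matching (G : sgraph) (M : {set {set G}}) : bool :=
  (M \subset edges G) && trivIset M.

Definition nearly_perfect_matching (G : sgraph) (M : {set {set G}}) : bool :=
  is_matching M && (#|~: cover M| <= 1)%N.

(* Main.v *)
Require Import Defs.
From HB Require Import structures.
From mathcomp Require Import all_boot all_order all_algebra.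
From mathcomp Require Import reals exp.
From mathcomp Require Import ring lra.

(** Write [n = #|G| <= 2k + 1], so that all degrees are at most [2k].  Then each
    edge [uv] weighs at least [c / sqrt d(u) + c / sqrt d(v)] with
    [c = 1 / (2 sqrt (2k))]; use this bound only off the matching.  Summing over
    vertices, the edges incident to [v] contribute [c d(v) / sqrt d(v)], so
    [R(G)] is at least the sum over matching edges [uv] of
    [1 / sqrt (d(u) d(v)) + c (sqrt d(u) - 1 / sqrt d(u) + sqrt d(v) - 1 / sqrt d(v))].
    With [t^4 = d(u) d(v)] each term is at least [1 / t^2 + 2 c (t - 1)], and
    AM-GM for [k / t^2], [c k t], [c k t] concludes. *)

Set Implicit Arguments.
Unset Strict Implicit.
Unset Printing Implicit Defensive.

Import Order.TTheory GRing.Theory Num.Theory.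
Local Open Scope ring_scope.

Section Graph.
Variable G : sgraph.
Implicit Types (u v : G) (f : {set G}) (M : {set {set G}}).

Lemma edgesP f :
  reflect (exists u v, adj u v /\ f = [set u; v]) (f \in edges G).
Proof.
apply: (iffP imsetP) => [[[u v]]|[u [v [uv ->]]]].
  by rewrite inE /= => uv ->; exists u, v.
by exists (u, v); rewrite ?inE.
Qed.

Lemma adj_neq u v : adj u v -> u != v.
Proof. by apply: contraTneq => ->; rewrite adj_irrefl. Qed.

Lemma deg_gt0 u v : adj u v -> (0 < deg u)%N.
Proof. by move=> uv; apply/card_gt0P; exists v; rewrite inE. Qed.

Lemma deg_lt_card v : (deg v < #|G|)%N.
Proof.
rewrite -cardsT; apply/proper_card/properP; split; first exact: subsetT.
by exists v; rewrite ?inE ?adj_irrefl.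
Qed.

Lemma card_incident_edges v : #|[set f in edges G | v \in f]| = deg v.
Proof.
have -> : [set f in edges G | v \in f] =
          [set [set v; w] | w in [set w | adj v w]].
  apply/setP => f; rewrite !inE; apply/andP/imsetP => [[]|[w]].
    move=> /edgesP[a [b [ab ->]]]; rewrite !inE => /orP[]/eqP->.
      by exists b; rewrite ?inE.
    by exists a; rewrite ?inE 1?adj_sym // setUC.
  rewrite inE => vw ->; split; last by rewrite !inE eqxx.
  by apply/edgesP; exists v, w.
(* Injectivity: [w] lies in [[set v; w']] and differs from [v], so it equals [w']. *)
apply: card_in_imset => w w'; rewrite !inE => vw _ /setP/(_ w).
by rewrite !inE eqxx orbT eq_sym (negbTE (adj_neq vw)) => /esym/eqP.
Qed.

(** Double counting: after exchanging the sums, [g v] occurs once per edge at [v]. *)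
Lemma sum_edges_incident (R : realType) (g : G -> R) :
  \sum_(f in edges G) \sum_(v in f) g v = \sum_v (deg v)%:R * g v.
Proof.
rewrite (exchange_big_dep predT) //=; apply: eq_bigr => v _.
rewrite sumr_const -card_incident_edges mulr_natl; congr (_ *+ _).
by apply: eq_card => f; rewrite !inE.
Qed.

Lemma card_cover_matching M : is_matching M -> #|cover M| = (2 * #|M|)%N.
Proof.
case/andP => /subsetP sub /eqP <-.
rewrite mulnC -sum_nat_const; apply: eq_bigr => f /sub /edgesP[u [v [uv ->]]].
by rewrite cards2 adj_neq.
Qed.

Lemma deg_nearly_perfect M v :
  nearly_perfect_matching M -> (deg v <= 2 * #|M|)%N.
Proof.
case/andP => /card_cover_matching <- unc; rewrite -ltnS.
by rewrite (leq_trans (deg_lt_card v)) // -(cardsC (cover M)) -addn1 leq_add2l.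
Qed.

End Graph.

Section Inequalities.
Variable R : realType.

(** AM-GM for [a], [b], [b] with geometric mean [m], free of cube roots: multiplying the difference
    by [b ^+ 2] gives a polynomial with the double root [m = b]. *)
Lemma amgm3 (a b m : R) : 0 <= m -> 0 < b -> a * b ^+ 2 = m ^+ 3 ->
  3 * m <= a + 2 * b.
Proof.
move=> m0 b0 e; rewrite -subr_ge0 -(pmulr_lge0 _ (exprn_gt0 2 b0)).
have -> : (a + 2 * b - 3 * m) * b ^+ 2 = (m - b) ^+ 2 * (m + 2 * b).
  by rewrite mulrBl mulrDl e; ring.
by rewrite mulr_ge0 ?sqr_ge0 // addr_ge0 // mulr_ge0 // ltW.
Qed.

(** Multiplied by [a * b], this is [a + b <= 2 * N]. It serves with square roots of degrees for [a],
    [b] and of the degree bound for [N]. *)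
Lemma invr_mul_ge (N a b : R) : 0 < a <= N -> 0 < b <= N ->
  (2 * N)^-1 * (a^-1 + b^-1) <= (a * b)^-1.
Proof.
move=> /andP[a0 aN] /andP[b0 bN]; have N0 := lt_le_trans a0 aN.
have -> : (2 * N)^-1 * (a^-1 + b^-1) = (a + b) / (2 * N) * (a * b)^-1.
  by field; rewrite !gt_eqF.
rewrite ler_piMl //; first by rewrite invr_ge0 mulr_ge0 ?ltW.
by rewrite ler_pdivrMr; lra.
Qed.

(** Here [a], [b] stand for square roots of degrees. The first summands agree; the rest follows from
    [a + b >= 2 * sqrt (a * b)] and [a^-1, b^-1 <= 1]. *)
Lemma matching_term_ge (c a b : R) : 0 <= c -> 1 <= a -> 1 <= b ->
  (Num.sqrt (a * b) ^+ 2)^-1 + 2 * c * (Num.sqrt (a * b) - 1) <=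
  (a * b)^-1 + c * ((a - a^-1) + (b - b^-1)).
Proof.
move=> c0 a1 b1; have a0 := lt_le_trans ltr01 a1; have b0 := lt_le_trans ltr01 b1.
have ab0 := ltW (mulr_gt0 a0 b0).
rewrite sqr_sqrtr // lerD2l -mulrA mulrCA ler_wpM2l //.
have ai : a^-1 <= 1 by rewrite invf_le1.
have bi : b^-1 <= 1 by rewrite invf_le1.
have : 2 * Num.sqrt (a * b) <= a + b.
  rewrite -[a in _ <= a + _](sqr_sqrtr (ltW a0)).
  rewrite -[b in _ <= _ + b](sqr_sqrtr (ltW b0)) (sqrtrM _ (ltW a0)).
  have := sqr_ge0 (Num.sqrt a - Num.sqrt b); rewrite sqrrB; lra.
lra.
Qed.

Lemma powR_two_thirds_cube (x : R) : 0 <= x -> (x `^ (2 / 3)) ^+ 3 = x ^+ 2.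
Proof.
move=> x0; rewrite -powR_mulrn ?powR_ge0 // -powRrM divfK ?pnatr_eq0 //.
by rewrite -powR_mulrn.
Qed.

Lemma optimized_term_ge (x t : R) : 0 < x -> 0 < t ->
  (3 * (x `^ (2 / 3)) / 2 - Num.sqrt (x / 2)) / x <=
  (t ^+ 2)^-1 + 2 * (2 * Num.sqrt (2 * x))^-1 * (t - 1).
Proof.
move=> x0 t0; set m := x `^ _; set s := Num.sqrt (x / 2).
have s0 : 0 < s by rewrite sqrtr_gt0 divr_gt0.
have s2 : s ^+ 2 = x / 2 by rewrite sqr_sqrtr // divr_ge0 // ltW.
have xE : x = 2 * s ^+ 2 by rewrite s2; field.
have -> : Num.sqrt (2 * x) = 2 * s.
  rewrite xE mulrA -natrM -[RHS]ger0_norm ?mulr_ge0 ?ltW // -sqrtr_sqr.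
  by congr Num.sqrt; ring.
(* The product [(x / t ^+ 2) * (s * t / 2) ^+ 2] is [x * s ^+ 2 / 4 = x ^+ 2 / 8], independent of
   [t] and equal to [(m / 2) ^+ 3]. *)
have amgm : 3 * (m / 2) <= x / t ^+ 2 + 2 * (s * t / 2).
  apply: amgm3; rewrite ?divr_ge0 ?powR_ge0 ?divr_gt0 ?mulr_gt0 //.
  rewrite [RHS]expr_div_n powR_two_thirds_cube ?ltW // xE.
  by field; rewrite gt_eqF.
rewrite ler_pdivrMr //.
have -> : ((t ^+ 2)^-1 + 2 * (2 * (2 * s))^-1 * (t - 1)) * x =
          x / t ^+ 2 + s * t - s.
  by rewrite xE; field; rewrite !gt_eqF.
lra.
Qed.

End Inequalities.

Lemma randic_edge_ge (R : realType) (G : sgraph) (N : nat) (f : {set G}) :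
    (forall v : G, deg v <= N)%N -> f \in edges G ->
  (2 * Num.sqrt N%:R)^-1 * \sum_(v in f) (Num.sqrt (deg v)%:R)^-1 <=
  (Num.sqrt (\prod_(v in f) (deg v)%:R))^-1 :> R.
Proof.
move=> degN /edgesP[u [v [uv ->]]].
have vu : adj v u by rewrite adj_sym.
have uNv := adj_neq uv.
rewrite !big_setU1 ?inE //= !big_set1 sqrtrM ?ler0n //.
by apply: invr_mul_ge;
  rewrite sqrtr_gt0 ltr0n ler_wsqrtr ?ler_nat ?degN // ?(deg_gt0 uv) ?(deg_gt0 vu).
Qed.

(** Matching edges keep their exact weight, so the bound [h] that the sum over all edges credits to
    them is taken off again: this is the subtracted inverse. *)
Lemma randic_ge_sum_matching (R : realType) (G : sgraph) (N : nat)
    (M : {set {set G}}) :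
    (forall v : G, deg v <= N)%N -> is_matching M ->
  \sum_(f in M) ((Num.sqrt (\prod_(v in f) (deg v)%:R))^-1 +
      (2 * Num.sqrt N%:R)^-1 *
      \sum_(v in f) (Num.sqrt (deg v)%:R - (Num.sqrt (deg v)%:R)^-1)) <=
  randic R G.
Proof.
move=> degN /andP[subM triv].
pose s (v : G) : R := Num.sqrt (deg v)%:R; set c := (_)^-1.
pose w (f : {set G}) : R := (Num.sqrt (\prod_(v in f) (deg v)%:R))^-1.
pose h (f : {set G}) := c * \sum_(v in f) (s v)^-1.
have c0 : 0 <= c by rewrite invr_ge0 mulr_ge0 ?sqrtr_ge0.
have sumh : c * \sum_(f in M) \sum_(v in f) s v <= \sum_(f in edges G) h f.
  rewrite -mulr_sumr ler_wpM2l // sum_edges_incident -big_trivIset //=.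
  (* Vertices outside the matching contribute a nonnegative amount and are dropped. *)
  rewrite [leRHS](bigID (mem (cover M))) /= ler_wpDr ?sumr_ge0 //.
    by move=> v _; rewrite mulr_ge0 ?ler0n // invr_ge0 sqrtr_ge0.
  apply: ler_sum => v _; rewrite -[X in X / _]sqr_sqrtr ?ler0n // -/(s v).
  (* For degree 0 both sides vanish, as the inverse of 0 is 0. *)
  by have [->|s0] := eqVneq (s v) 0; rewrite ?invr0 ?mulr0 // expr2 mulfK.
have off : \sum_(f in edges G :\: M) h f <= \sum_(f in edges G :\: M) w f.
  by apply: ler_sum => f /setDP[fE _]; apply: randic_edge_ge.
have split_edges (g : {set G} -> R) : \sum_(f in edges G) g f =
    \sum_(f in M) g f + \sum_(f in edges G :\: M) g f.
  by rewrite (big_setID M) (setIidPr subM).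
rewrite /randic split_edges.
under eq_bigr do rewrite sumrB mulrBr.
rewrite big_split sumrB /= -mulr_sumr.
move: sumh; rewrite split_edges => sumh.
rewrite lerD2l -/h lerBlDl; apply: le_trans sumh _.
by rewrite lerD2l.
Qed.

Theorem theorem5p2 (R : realType) (k : nat) (hk : (0 < k)%N) (G : sgraph)
    (M : {set {set G}}) (hM : nearly_perfect_matching M) (hMk : #|M| = k) :
  3 * (k%:R `^ (2 / 3)) / 2 - Num.sqrt (k%:R / 2) <= randic R G.
Proof.
have degN (v : G) : (deg v <= 2 * k)%N by rewrite -hMk deg_nearly_perfect.
have /andP[mM _] := hM; have /andP[/subsetP subM _] := mM.
apply: le_trans (randic_ge_sum_matching R degN mM).
set L := (_ - _ : R).
have k0 : 0 < k%:R :> R by rewrite ltr0n.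
(* The bound is shared equally among the [k] matching edges, so it suffices to compare term by
   term. *)
have -> : L = \sum_(f in M) L / k%:R.
  by rewrite sumr_const hMk -[RHS]mulr_natr divfK // gt_eqF.
apply: ler_sum => f /subM /edgesP[u [v [uv ->]]].
have vu : adj v u by rewrite adj_sym.
rewrite !big_setU1 ?inE ?adj_neq //= !big_set1 sqrtrM ?ler0n //.
have s1 (x y : G) : adj x y -> 1 <= Num.sqrt (deg x)%:R :> R.
  by move=> xy; rewrite -[leLHS]sqrtr1 ler_wsqrtr // ler1n (deg_gt0 xy).
have su := s1 _ _ uv; have sv := s1 _ _ vu.
apply: le_trans (matching_term_ge _ su sv); last first.
  by rewrite invr_ge0 mulr_ge0 ?sqrtr_ge0.
rewrite natrM; apply: optimized_term_ge => //.
by rewrite sqrtr_gt0 mulr_gt0 // (lt_le_trans ltr01).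
Qed.
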